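(* Let $B>0$ and consider the transmission-time minimization problem $\mathcal T$ for the single-user Gaussian channel with an energy harvesting source that has $B$ bits to send. If an online algorithm $A$ for $\mathcal T$ is $r_A$-competitive, then $r_A \ge 1.38$.
   Context: All logarithms are base 2. Energy arrivals. An energy arrival sequence $\boldsymbol\sigma$ is a finite or infinite sequence of pairs $(t_i,E_i)$, $i=0,1,2,\dots$, with $0=t_0<t_1<t_2<\cdots$ (with $t_i\to\infty$ if the sequence is infinite) and $E_i>0$: the source receives energy $E_i$ at time $t_i$. The sequence is arbitrary (no distribution is assumed). Transmission. All $B$ bits are available at time $0$. The source uses a piecewise constant nonnegative transmit power $P(t)$, $t\ge 0$, with finitely many changes on any bounded time interval. Transmitting with constant power $P$ for a duration $T$ uses energy $PT$ and sends $T\log(1+P)$ bits. Thus by time $t$ the number of bits sent is $B(t)=\int_0^t\log(1+P(s))\,ds$ and the energy used is $E(t)=\int_0^t P(s)\,ds$. The power profile is feasible for $\boldsymbol\sigma$ if it satisfies energy neutrality: $E(t)\le\sum_{i:\,t_i\le t}E_i$ for all $t\ge0$. The completion time of a profile is the smallest $T$ with $B(T)=B$ ($+\infty$ if there is none). Problem $\mathcal T$. Minimize the completion time over feasible power profiles. The optimal offline algorithm $O$ knows all of $\boldsymbol\sigma$ in advance; $\mathcal T_O(\boldsymbol\sigma)$ denotes the minimum completion time over all power profiles feasible for $\boldsymbol\sigma$ ($+\infty$ if no feasible profile completes). Online algorithms. A (deterministic) online algorithm $A$ assigns to each $\boldsymbol\sigma$ a feasible power profile causally: the power used at time $t$ depends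 only on the arrivals $(t_i,E_i)$ with $t_i\le t$ (so if two sequences have the same arrivals up to time $t$, the two power profiles agree on $[0,t]$). $\mathcal T_A(\boldsymbol\sigma)$ denotes its completion time on $\boldsymbol\sigma$. Competitiveness. $A$ is $r_A$-competitive if $\mathcal T_A(\boldsymbol\sigma)/\mathcal T_O(\boldsymbol\sigma)\le r_A$ for every energy arrival sequence $\boldsymbol\sigma$ with $\mathcal T_O(\boldsymbol\sigma)<\infty$. *)

(* Defs.v *)
From Stdlib Require Import Reals.
From Coquelicot Require Import Coquelicot.

Open Scope R_scope.

(* [last_arrival = None]: infinitely many arrivals; [last_arrival = Some n]:
   exactly the arrivals 0, ..., n.  Values of [arr_time] and [arr_energy] at
   larger indices are meaningless and nothing below depends on them. *)
Definition in_range (last : option nat) (i : nat) : bool :=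
  match last with
  | None => true
  | Some n => Nat.leb i n
  end.

Record energy_arrivals := {
  last_arrival : option nat;
  arr_time : nat -> R;
  arr_energy : nat -> R;
  arr_time_0 : arr_time 0 = 0;
  arr_time_incr : forall i : nat,
    in_range last_arrival (S i) = true -> arr_time i < arr_time (S i);
  arr_energy_pos : forall i : nat,
    in_range last_arrival i = true -> 0 < arr_energy i;
  arr_time_lim : last_arrival = None -> is_lim_seq arr_time p_infty
}.

Definition arrives (sigma : energy_arrivals) (t e : R) : Prop :=
  exists i : nat, in_range (last_arrival sigma) i = true /\
    arr_time sigma i = t /\ arr_energy sigma i = e.

(* Only finitely many terms are nonzero, so the series is a finite sum. *)
Definition harvested (sigma : energy_arrivals) (t : R) : R :=
  Series (fun i : nat =>
    if in_range (last_arrival sigma) i then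
      if Rle_dec (arr_time sigma i) t then arr_energy sigma i else 0
    else 0).

Definition log2 (x : R) : R := ln x / ln 2.

(* Values at negative times are irrelevant.  [IsStepFun] asks for constancy on
   the open pieces of a finite subdivision; values at the breakpoints are free
   and do not influence the integrals below. *)
Definition power_profile (P : R -> R) : Prop :=
  (forall t : R, 0 <= t -> 0 <= P t) /\
  (forall t : R, 0 <= t -> inhabited (IsStepFun P 0 t)).

Definition bits_sent (P : R -> R) (t : R) : R :=
  RInt (fun s : R => log2 (1 + P s)) 0 t.

Definition energy_used (P : R -> R) (t : R) : R := RInt P 0 t.

Definition feasible (sigma : energy_arrivals) (P : R -> R) : Prop :=
  power_profile P /\
  forall t : R, 0 <= t -> energy_used P t <= harvested sigma t.

(* [bits_sent P] is continuous, so when the set is nonempty the infimum is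
   attained; it is [p_infty] when the set is empty. *)
Definition completion_time (B : R) (P : R -> R) : Rbar :=
  Glb_Rbar (fun T : R => 0 <= T /\ bits_sent P T = B).

(* The infimum is [p_infty] if no feasible profile completes.  Otherwise it is
   attained: by concavity of the rate one may restrict to profiles that are
   constant between consecutive arrivals, and only finitely many arrivals
   matter. *)
Definition offline_time (B : R) (sigma : energy_arrivals) : Rbar :=
  Glb_Rbar (fun T : R => exists P : R -> R,
    feasible sigma P /\ completion_time B P = Finite T).

Definition same_arrivals_upto (t : R) (sigma sigma' : energy_arrivals) : Prop :=
  forall u e : R, u <= t -> (arrives sigma u e <-> arrives sigma' u e).

Record online_algorithm := {
  alg_power :> energy_arrivals -> R -> R;
  alg_feasible : forall sigma : energy_arrivals,
    feasible sigma (alg_power sigma);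
  alg_causal : forall (sigma sigma' : energy_arrivals) (t : R),
    0 <= t -> same_arrivals_upto t sigma sigma' ->
    forall u : R, 0 <= u <= t -> alg_power sigma u = alg_power sigma' u
}.

Definition online_time (B : R) (A : online_algorithm)
    (sigma : energy_arrivals) : Rbar :=
  completion_time B (A sigma).

(* For B > 0 the offline time is positive, so the quotient is the genuine one;
   it is [p_infty] when the algorithm does not complete. *)
Definition competitive (B : R) (A : online_algorithm) (r : R) : Prop :=
  forall sigma : energy_arrivals,
    Rbar_lt (offline_time B sigma) p_infty ->
    Rbar_le (Rbar_div (online_time B A sigma) (offline_time B sigma)) (Finite r).

(* Main.v *)
(* Let b = B ln 2; energy below b never suffices for B bits.  If only
   E0 = (1 + 1/10000) b arrives at time 0, completion is possible but only at
   very low power, so every algorithm that completes has sent almost nothing by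
   time b.  Let now a second amount B - b arrive at time b.  Offline, power 1
   throughout sends one bit per unit of time and finishes by time B.  The online
   algorithm cannot tell the two sequences apart before time b, and concavity of
   the rate shows that the bits it can still send in [b, 2b] do not suffice.  It
   therefore needs time at least 2b = 2 B ln 2 > 1.38 B. *)

Require Import Defs.
From Stdlib Require Import Reals Lra Lia List.
From Coquelicot Require Import Coquelicot.
Open Scope R_scope.

(** * Step functions and their integrals *)

Lemma IsStepFun_const_open (f : R -> R) (a b c : R) :
  a <= b -> (forall x, a < x < b -> f x = c) -> IsStepFun f a b.
Proof.
  intros Hab Hf.
  exists (a :: b :: nil)%list, (c :: nil)%list.
  destruct (StepFun_P3 c Hab) as (H1 & H2 & H3 & H4 & _).
  repeat split; try assumption.
  simpl; intros i Hi.
  assert (i = 0)%nat as -> by lia.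
  exact Hf.
Qed.

Lemma pos_Rl_map (g : R -> R) (l : list R) (i : nat) :
  (i < length l)%nat -> RList.pos_Rl (map g l) i = g (RList.pos_Rl l i).
Proof.
  revert i; induction l as [|x l IH]; simpl; intros i Hi; [lia|].
  destruct i as [|i]; [reflexivity|].
  apply IH; lia.
Qed.

Lemma IsStepFun_comp (g f : R -> R) (a b : R) :
  IsStepFun f a b -> IsStepFun (fun x => g (f x)) a b.
Proof.
  intros (l & lf & H1 & H2 & H3 & H4 & H5).
  exists l, (map g lf).
  repeat split; try assumption.
  - rewrite length_map; exact H4.
  - intros i Hi x Hx.
    rewrite pos_Rl_map by lia.
    now rewrite (H5 i Hi x Hx).
Qed.

Lemma ex_RInt_IsStepFun (f : R -> R) (a b : R) :
  IsStepFun f a b -> ex_RInt f a b.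
Proof.
  intros Hf.
  apply ex_RInt_Reals_1.
  intros eps.
  (* A step function approximates itself with error function 0. *)
  exists (mkStepFun Hf), (mkStepFun (StepFun_P4 a b 0)); split.
  - intros t _; simpl; unfold fct_cte.
    rewrite Rminus_diag, Rabs_R0; lra.
  - rewrite StepFun_P18, Rmult_0_l, Rabs_R0.
    apply cond_pos.
Qed.

Lemma ex_RInt_profile_comp (g P : R -> R) (u v : R) :
  power_profile P -> 0 <= u <= v -> ex_RInt (fun s => g (P s)) u v.
Proof.
  intros [_ HP] Huv.
  apply (ex_RInt_Chasles_2 (fun s => g (P s)) 0 u v Huv).
  destruct (HP v) as [Hv]; [lra|].
  now apply ex_RInt_IsStepFun, IsStepFun_comp.
Qed.

(** * Energy and bits over a time interval *)

Lemma energy_used_Chasles (P : R -> R) (u v : R) :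
  power_profile P -> 0 <= u <= v ->
  energy_used P v = energy_used P u + RInt P u v.
Proof.
  intros HP Huv; unfold energy_used.
  symmetry; apply (RInt_Chasles P);
    apply (ex_RInt_profile_comp (fun x => x)); trivial; lra.
Qed.

Lemma bits_sent_Chasles (P : R -> R) (u v : R) :
  power_profile P -> 0 <= u <= v ->
  bits_sent P v = bits_sent P u + RInt (fun s => log2 (1 + P s)) u v.
Proof.
  intros HP Huv; unfold bits_sent.
  symmetry; apply (RInt_Chasles (fun s => log2 (1 + P s)));
    apply (ex_RInt_profile_comp (fun x => log2 (1 + x))); trivial; lra.
Qed.

Lemma ln_2_pos : 0 < ln 2.
Proof. pose proof ln_lt_2; lra. Qed.

Lemma log2_ge_0 (p : R) : 0 <= p -> 0 <= log2 (1 + p).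
Proof.
  intros Hp; unfold log2.
  apply Rdiv_le_0_compat; [|exact ln_2_pos].
  rewrite <- ln_1; apply ln_le; lra.
Qed.

Lemma RInt_profile_ge_0 (P : R -> R) (u v : R) :
  power_profile P -> 0 <= u <= v -> 0 <= RInt P u v.
Proof.
  intros HP Huv.
  apply RInt_ge_0; [lra| |].
  - now apply (ex_RInt_profile_comp (fun x => x)).
  - intros x Hx; apply HP; lra.
Qed.

Lemma bits_sent_le (P : R -> R) (u v : R) :
  power_profile P -> 0 <= u <= v -> bits_sent P u <= bits_sent P v.
Proof.
  intros HP Huv.
  rewrite (bits_sent_Chasles P u v HP Huv).
  enough (0 <= RInt (fun s => log2 (1 + P s)) u v) by lra.
  apply RInt_ge_0; [lra| |].
  - now apply (ex_RInt_profile_comp (fun x => log2 (1 + x))).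
  - intros x Hx; apply log2_ge_0, HP; lra.
Qed.

(** Integrating an affine majorant of the rate leaves only the duration and the energy spent. With
    tangent lines as majorants this takes the place of Jensen's inequality. *)
Lemma RInt_log2_le_affine (P : R -> R) (u v alpha gamma : R) :
  power_profile P -> 0 <= u <= v ->
  (forall p, 0 <= p -> ln (1 + p) <= alpha + gamma * p) ->
  ln 2 * RInt (fun s => log2 (1 + P s)) u v
    <= alpha * (v - u) + gamma * RInt P u v.
Proof.
  intros HP Huv Hln.
  pose proof ln_2_pos as H2.
  assert (HexP : ex_RInt P u v)
    by now apply (ex_RInt_profile_comp (fun x => x)).
  assert (Hexl : ex_RInt (fun s => log2 (1 + P s)) u v)
    by now apply (ex_RInt_profile_comp (fun x => log2 (1 + x))).
  replace (alpha * (v - u)) with ((v - u) * alpha) by ring.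
  apply (is_RInt_le (fun s => ln 2 * log2 (1 + P s))
    (fun s => alpha + gamma * P s) u v); [lra| | |].
  - apply (is_RInt_scal (fun s => log2 (1 + P s)) u v (ln 2)).
    apply (RInt_correct _ u v Hexl).
  - apply (is_RInt_plus (fun _ => alpha) (fun s => gamma * P s)).
    + apply (is_RInt_const u v alpha).
    + apply (is_RInt_scal P u v gamma).
      apply (RInt_correct _ u v HexP).
  - intros s Hs.
    replace (ln 2 * log2 (1 + P s)) with (ln (1 + P s))
      by (unfold log2; field; lra).
    apply Hln, HP; lra.
Qed.

(** * Tangent lines of the logarithm and bounds on [ln 2] *)

Lemma ln_le_tangent (c x : R) : 0 < c -> 0 < x -> ln x <= ln c + (x / c - 1).
Proof.
  intros Hc Hx.
  assert (Hxc : 0 < x / c) by now apply Rdiv_lt_0_compat.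
  replace (ln x) with (ln c + ln (x / c))
    by (rewrite <- ln_mult by assumption; f_equal; field; lra).
  pose proof (exp_ineq1_le (ln (x / c))) as H.
  rewrite exp_ln in H by assumption; lra.
Qed.

(** The tangent at [p = 1], the power of the offline profile used for comparison. *)
Lemma ln_1p_le_tangent_1 (p : R) : 0 <= p -> ln (1 + p) <= ln 2 - / 2 + / 2 * p.
Proof.
  intros Hp.
  pose proof (ln_le_tangent 2 (1 + p)); lra.
Qed.

Lemma ln_1p_le (p : R) : 0 <= p -> ln (1 + p) <= 0 + 1 * p.
Proof.
  intros Hp.
  pose proof (ln_le_tangent 1 (1 + p)) as H.
  rewrite ln_1 in H; lra.
Qed.

(* Tangent line at [p = 1/40]. *)
Lemma ln_1p_le_tangent_40 (p : R) :
  0 <= p -> ln (1 + p) <= / 1640 + 40 / 41 * p.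
Proof.
  intros Hp.
  pose proof (ln_le_tangent (41 / 40) (1 + p)).
  (* Bounding [ln (41 / 40)] by [1 / 40] raises the tangent slightly and makes its constant term
     [1/40 - 1/41 = 1/1640]. *)
  pose proof (ln_1p_le (/ 40)) as H1.
  replace (1 + / 40) with (41 / 40) in H1 by field.
  lra.
Qed.

(** The rational inequality [2 <= (1 + 0.7 / 64) ^ 64] combined with [ln (1 + x) < x]. The lower
    bound below uses [1 / 2 <= (1 - 0.69 / 128) ^ 128] in the same way. *)
Lemma ln_2_lt : ln 2 < 0.7.
Proof.
  assert (H : ln 2 <= 64 * ln (1 + 0.7 / 64)).
  { replace 64 with (INR 64) at 1 by (simpl; ring).
    rewrite <- ln_pow by lra.
    apply ln_le; lra. }
  assert (ln (1 + 0.7 / 64) < 0.7 / 64); [|lra].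
  apply exp_lt_inv.
  rewrite exp_ln by lra.
  apply exp_ineq1; lra.
Qed.

Lemma ln_2_gt : 0.69 < ln 2.
Proof.
  assert (H : - ln 2 <= 128 * ln (1 - 0.69 / 128)).
  { replace 128 with (INR 128) at 1 by (simpl; ring).
    rewrite <- ln_pow by lra.
    rewrite <- ln_Rinv by lra.
    apply ln_le; lra. }
  assert (ln (1 - 0.69 / 128) < - (0.69 / 128)); [|lra].
  apply exp_lt_inv.
  rewrite exp_ln by lra.
  apply exp_ineq1; lra.
Qed.

(** * Sequences with one or two arrivals *)

Lemma Series_finite_support (a : nat -> R) (n : nat) :
  (forall i, (n < i)%nat -> a i = 0) -> Series a = sum_n a n.
Proof.
  intros Ha; apply is_series_unique.
  change (is_lim_seq (sum_n a) (sum_n a n)).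
  apply (is_lim_seq_ext_loc (fun _ => sum_n a n)); [|apply is_lim_seq_const].
  exists n; intros m Hm.
  induction Hm as [|m Hm IH]; [reflexivity|].
  rewrite sum_Sn, <- IH, Ha by lia.
  symmetry; apply Rplus_0_r.
Qed.

Definition one_arrival (E : R) (hE : 0 < E) : energy_arrivals.
Proof.
  refine {| last_arrival := Some 0%nat;
            arr_time := fun _ => 0;
            arr_energy := fun _ => E |}.
  - reflexivity.
  - discriminate.
  - trivial.
  - discriminate.
Defined.

Definition two_arrivals (t1 E0 E1 : R)
  (ht : 0 < t1) (hE0 : 0 < E0) (hE1 : 0 < E1) : energy_arrivals.
Proof.
  refine {| last_arrival := Some 1%nat;
            arr_time := fun i => match i with O => 0 | S _ => t1 end;
            arr_energy := fun i => match i with O => E0 | S _ => E1 end |}.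
  - reflexivity.
  - intros [|i]; [trivial|discriminate].
  - intros [|i]; trivial.
  - discriminate.
Defined.

Lemma harvested_one_arrival (E : R) (hE : 0 < E) (t : R) :
  0 <= t -> harvested (one_arrival E hE) t = E.
Proof.
  intros Ht; unfold harvested.
  rewrite (Series_finite_support _ 0).
  - rewrite sum_O; simpl.
    destruct (Rle_dec 0 t); lra.
  - intros [|i] Hi; [lia|reflexivity].
Qed.

Lemma harvested_two_arrivals (t1 E0 E1 : R)
  (ht : 0 < t1) (hE0 : 0 < E0) (hE1 : 0 < E1) (t : R) :
  0 <= t -> harvested (two_arrivals t1 E0 E1 ht hE0 hE1) t
            = E0 + (if Rle_dec t1 t then E1 else 0).
Proof.
  intros Ht; unfold harvested.
  rewrite (Series_finite_support _ 1).
  - rewrite sum_Sn, sum_O; simpl.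
    unfold plus; simpl.
    destruct (Rle_dec 0 t); [reflexivity|lra].
  - intros [|[|i]] Hi; [lia|lia|reflexivity].
Qed.

Lemma same_arrivals_before_second (t1 E0 E1 : R)
  (ht : 0 < t1) (hE0 : 0 < E0) (hE1 : 0 < E1) (t : R) :
  t < t1 ->
  same_arrivals_upto t (one_arrival E0 hE0) (two_arrivals t1 E0 E1 ht hE0 hE1).
Proof.
  intros Ht u e Hu; split.
  - intros (i & _ & H1 & H2).
    exists 0%nat; auto.
  - intros ([|i] & _ & H1 & H2); simpl in H1, H2; [|lra].
    exists 0%nat; auto.
Qed.

(** * Constant power up to a deadline *)

(** The power drops to 0 at [T] because energy neutrality is demanded at all times, also after
    completion. *)
Definition constant_until (q T s : R) : R := if Rlt_dec s T then q else 0.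

Lemma power_profile_constant_until (q T : R) :
  0 <= q -> 0 <= T -> power_profile (constant_until q T).
Proof.
  intros Hq HT; unfold constant_until; split; intros t Ht.
  - destruct (Rlt_dec t T); lra.
  - constructor.
    destruct (Rle_dec t T) as [H|H].
    + apply IsStepFun_const_open with q; [exact Ht|].
      intros x Hx; destruct (Rlt_dec x T); lra.
    + apply StepFun_P41 with T; [lra|lra| |].
      * apply IsStepFun_const_open with q; [lra|].
        intros x Hx; destruct (Rlt_dec x T); lra.
      * apply IsStepFun_const_open with 0; [lra|].
        intros x Hx; destruct (Rlt_dec x T); lra.
Qed.

Lemma energy_used_constant_until (q T t : R) :
  0 <= q -> 0 <= T -> 0 <= t ->
  energy_used (constant_until q T) t = q * Rmin t T.
Proof.
  intros Hq HT Ht.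
  assert (H : forall s, 0 <= s <= T -> energy_used (constant_until q T) s = q * s).
  { intros s Hs; unfold energy_used.
    rewrite (RInt_ext _ (fun _ => q)).
    - rewrite RInt_const; unfold scal; simpl; unfold mult; simpl; ring.
    - intros x; rewrite Rmin_left, Rmax_right by lra; intros Hx.
      unfold constant_until; destruct (Rlt_dec x T); lra. }
  destruct (Rle_dec t T) as [HtT|HtT].
  - rewrite Rmin_left by lra; apply H; lra.
  - rewrite Rmin_right by lra.
    rewrite (energy_used_Chasles _ T t)
      by (try apply power_profile_constant_until; lra).
    rewrite H by lra.
    rewrite (RInt_ext _ (fun _ => 0)).
    + rewrite RInt_const; unfold scal; simpl; unfold mult; simpl; ring.
    + intros x; rewrite Rmin_left, Rmax_right by lra; intros Hx.
      unfold constant_until; destruct (Rlt_dec x T); lra.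
Qed.

Lemma bits_sent_constant_until (q T : R) :
  0 <= T -> bits_sent (constant_until q T) T = T * log2 (1 + q).
Proof.
  intros HT; unfold bits_sent.
  rewrite (RInt_ext _ (fun _ => log2 (1 + q))).
  - rewrite RInt_const; unfold scal; simpl; unfold mult; simpl; ring.
  - intros x; rewrite Rmin_left, Rmax_right by lra; intros Hx.
    unfold constant_until; destruct (Rlt_dec x T); [reflexivity|lra].
Qed.

(** * Completion times as infima, and the competitive ratio *)

Lemma completion_time_le (B : R) (P : R -> R) (T : R) :
  0 <= T -> bits_sent P T = B -> Rbar_le (completion_time B P) T.
Proof.
  intros HT HB.
  apply (proj1 (Glb_Rbar_correct _)); auto.
Qed.

Lemma completion_time_ge (B : R) (P : R -> R) (c : R) :
  (forall T, 0 <= T -> bits_sent P T = B -> c <= T) ->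
  Rbar_le c (completion_time B P).
Proof.
  intros H.
  apply (proj2 (Glb_Rbar_correct _)).
  intros T [HT HB]; simpl; auto.
Qed.

Lemma completion_time_lt_p_infty (B : R) (P : R -> R) :
  Rbar_lt (completion_time B P) p_infty ->
  exists T, 0 <= T /\ bits_sent P T = B.
Proof.
  intros H.
  destruct (Classical_Prop.classic (exists T, 0 <= T /\ bits_sent P T = B))
    as [Hex|Hno]; [exact Hex|exfalso].
  assert (Hle : Rbar_le p_infty (completion_time B P)).
  { apply (proj2 (Glb_Rbar_correct _)).
    intros T HT; exfalso; apply Hno; now exists T. }
  exact (Rbar_le_not_lt _ _ Hle H).
Qed.

Lemma offline_time_le (B : R) (sigma : energy_arrivals) (P : R -> R) (T : R) :
  feasible sigma P -> 0 <= T -> bits_sent P T = B ->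
  Rbar_le (offline_time B sigma) T.
Proof.
  intros HP HT HB.
  pose proof (completion_time_le B P T HT HB) as Hle.
  assert (Hge : Rbar_le 0 (completion_time B P))
    by (apply completion_time_ge; auto).
  (* [offline_time] ranges over finite completion times; lying between 0 and [T], this one is
     finite. *)
  destruct (completion_time B P) as [c| |] eqn:Hc;
    [|contradiction|contradiction].
  apply Rbar_le_trans with (Finite c); [|exact Hle].
  apply (proj1 (Glb_Rbar_correct _)).
  now exists P.
Qed.

Lemma offline_time_ge (B : R) (sigma : energy_arrivals) (c : R) :
  (forall P T, feasible sigma P -> 0 <= T -> bits_sent P T = B -> c <= T) ->
  Rbar_le c (offline_time B sigma).
Proof.
  intros H.
  apply (proj2 (Glb_Rbar_correct _)).
  intros T (P & HP & HT).
  rewrite <- HT.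
  apply completion_time_ge; eauto.
Qed.

Lemma competitive_completes (B : R) (A : online_algorithm) (r : R)
  (sigma : energy_arrivals) :
  competitive B A r -> 0 < offline_time B sigma ->
  Rbar_lt (offline_time B sigma) p_infty ->
  Rbar_le (online_time B A sigma) (r * offline_time B sigma).
Proof.
  intros HA Hpos Hfin.
  specialize (HA sigma Hfin).
  assert (Hon : Rbar_le 0 (online_time B A sigma))
    by (apply completion_time_ge; auto).
  destruct (offline_time B sigma) as [f| |]; simpl in *; try lra.
  pose proof (Rinv_0_lt_compat f Hpos) as Hinv.
  destruct (online_time B A sigma) as [c| |]; simpl in *.
  - apply Rmult_le_reg_r with (/ f); [exact Hinv|].
    replace (r * f * / f) with r by (field; lra).
    exact HA.
  (* Without completion the ratio is [p_infty] times the positive [/ f], that is [p_infty], which no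
     real [r] bounds. *)
  - unfold Rbar_div, Rbar_mult in HA; simpl in HA.
    destruct (Rle_dec 0 (/ f)) as [H|H]; [|lra].
    destruct (Rle_lt_or_eq_dec 0 (/ f) H); [exact HA|lra].
  - contradiction.
Qed.

(** * Bits against energy, and offline times of the two sequences *)

(** Agreement on the open interval matches what causality gives strictly before the second
    arrival. *)
Lemma bits_sent_eq (P Q : R -> R) (t : R) :
  0 <= t -> (forall u, 0 < u < t -> P u = Q u) -> bits_sent P t = bits_sent Q t.
Proof.
  intros Ht H; unfold bits_sent.
  apply RInt_ext.
  intros x; rewrite Rmin_left, Rmax_right by lra; intros Hx.
  now rewrite H.
Qed.

(** The tangent at [p = 1] integrated up to [T]; it turns an energy budget into a lower bound on the
    completion time. *)
Lemma completion_time_tradeoff (B E : R) (P : R -> R) (T : R) :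
  power_profile P -> 0 <= T -> energy_used P T <= E -> bits_sent P T = B ->
  B * ln 2 <= (ln 2 - / 2) * T + / 2 * E.
Proof.
  intros HP HT HE HB.
  pose proof (RInt_log2_le_affine P 0 T _ _ HP (conj (Rle_refl 0) HT)
    ln_1p_le_tangent_1) as H.
  fold (bits_sent P T) (energy_used P T) in H.
  rewrite HB in H; lra.
Qed.

(* [p - ln (1 + p)] is nonnegative and has integral at most [E - B * ln 2] up to
   time [T], hence also up to time [t]; it controls [ln (1 + p)] up to 1/40. *)
Lemma few_bits_early (B E : R) (P : R -> R) (t T : R) :
  power_profile P -> 0 <= t <= T ->
  energy_used P T <= E -> bits_sent P T = B ->
  ln 2 * bits_sent P t <= t / 40 + 40 * (E - B * ln 2).
Proof.
  intros HP Ht HE HB.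
  pose proof (RInt_log2_le_affine P 0 t _ _ HP (conj (Rle_refl 0) (proj1 Ht))
    ln_1p_le_tangent_40) as H1.
  fold (bits_sent P t) (energy_used P t) in H1.
  (* The bits still missing at [t] cost at least [ln 2] each, so the energy used by [t] is at most
     [E - B * ln 2 + ln 2 * bits_sent P t]. Inserting this into [H1] and multiplying by 41 gives the
     claim. *)
  pose proof (RInt_log2_le_affine P t T _ _ HP Ht ln_1p_le) as H2.
  pose proof (bits_sent_Chasles P t T HP Ht) as H3.
  pose proof (energy_used_Chasles P t T HP Ht) as H4.
  rewrite HB in H3; rewrite H3.
  assert (ln 2 * RInt (fun s => log2 (1 + P s)) t T
    = B * ln 2 - ln 2 * bits_sent P t) by (rewrite H3; ring).
  lra.
Qed.

(* Constant power [e] sends [B] bits with the available energy because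
   [e <= (1 + e) * ln (1 + e)]. *)
Lemma offline_one_arrival_finite (B e : R)
  (hE : 0 < (1 + e) * (B * ln 2)) :
  0 < B -> 0 < e ->
  Rbar_lt (offline_time B (one_arrival ((1 + e) * (B * ln 2)) hE)) p_infty.
Proof.
  intros hB he.
  pose proof ln_2_pos as H2.
  assert (Hln : 0 < ln (1 + e)) by (rewrite <- ln_1; apply ln_increasing; lra).
  assert (He : e <= (1 + e) * ln (1 + e)).
  (* The tangent at [1 + e], evaluated at 1, gives [1 - 1 / (1 + e) <= ln (1 + e)]. *)
  { pose proof (ln_le_tangent (1 + e) 1) as H; rewrite ln_1 in H.
    apply Rmult_le_reg_r with (/ (1 + e)); [apply Rinv_0_lt_compat; lra|].
    replace ((1 + e) * ln (1 + e) * / (1 + e)) with (ln (1 + e)) by (field; lra).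
    replace (e * / (1 + e)) with (1 - 1 / (1 + e)) by (field; lra).
    lra. }
  set (T := B * ln 2 / ln (1 + e)).
  assert (HT : 0 < T)
    by (apply Rdiv_lt_0_compat; [apply Rmult_lt_0_compat|]; assumption).
  assert (HTb : T * ln (1 + e) = B * ln 2) by (unfold T; field; lra).
  apply Rbar_le_lt_trans with (Finite T); [|exact I].
  apply offline_time_le with (constant_until e T); [split| |].
  - apply power_profile_constant_until; lra.
  - intros t Ht.
    rewrite harvested_one_arrival, energy_used_constant_until by lra.
    pose proof (Rmin_r t T).
    rewrite <- HTb; nra.
  - lra.
  - rewrite bits_sent_constant_until by lra.
    unfold log2.
    apply Rmult_eq_reg_r with (ln 2); [|lra].
    rewrite <- HTb; field; lra.
Qed.

(** Power 1 spends [t] by time [t]: before the second arrival [E0] covers this, and afterwards both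
    arrivals cover the total [B]. *)
Lemma offline_two_arrivals_le (B E0 E1 : R) (ht : 0 < B * ln 2)
  (hE0 : 0 < E0) (hE1 : 0 < E1) :
  B * ln 2 <= E0 -> B <= E0 + E1 -> 0 < B ->
  Rbar_le (offline_time B (two_arrivals (B * ln 2) E0 E1 ht hE0 hE1)) B.
Proof.
  intros H0 H1 hB.
  apply offline_time_le with (constant_until 1 B); [split| |].
  - apply power_profile_constant_until; lra.
  - intros t Ht.
    rewrite harvested_two_arrivals, energy_used_constant_until by lra.
    pose proof (Rmin_r t B); pose proof (Rmin_l t B).
    destruct (Rle_dec (B * ln 2) t); lra.
  - lra.
  - rewrite bits_sent_constant_until by lra.
    pose proof ln_2_pos.
    unfold log2; replace (1 + 1) with 2 by ring; field; lra.
Qed.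

(** * The adversary argument with its numerical margins *)

Theorem theorem1 (B : R) (hB : 0 < B) (A : online_algorithm) (rA : R)
  (hA : competitive B A rA) : 1.38 <= rA.
Proof.
  pose proof ln_2_lt as Hl2; pose proof ln_2_gt as Hg2.
  assert (Hb1 : B * ln 2 < 0.7 * B) by nra.
  assert (Hb2 : 0.69 * B < B * ln 2) by nra.
  set (b := B * ln 2) in *.
  assert (hb : 0 < b) by lra.
  assert (hE0 : 0 < (1 + / 10000) * b) by lra.
  set (E0 := (1 + / 10000) * b) in *.
  assert (hE1 : 0 < B - b) by lra.
  set (sigma1 := one_arrival E0 hE0).
  set (sigma2 := two_arrivals b E0 (B - b) hb hE0 hE1).
  (* If [T < b], the trade-off would bound [b] by [0.2 * b + (B + b / 10000) / 2], which is below
     [0.93 * b] since [B < b / 0.69]. This also makes both offline times positive. *)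
  assert (Hlate : forall P T E, power_profile P -> 0 <= T ->
    energy_used P T <= E -> E <= E0 + (B - b) -> bits_sent P T = B -> b <= T).
  { intros P T E HP HT HE HEE HB.
    pose proof (completion_time_tradeoff B E P T HP HT HE HB) as H.
    fold b in H; unfold E0 in HEE; nra. }
  assert (Hharv1 : forall t, 0 <= t -> harvested sigma1 t = E0)
    by (intros; now apply harvested_one_arrival).
  assert (Hharv2 : forall t, 0 <= t -> harvested sigma2 t <= E0 + (B - b)).
  { intros t Ht; unfold sigma2; rewrite harvested_two_arrivals by exact Ht.
    destruct (Rle_dec b t); lra. }
  assert (Hoff1 : Rbar_lt (offline_time B sigma1) p_infty)
    by (apply offline_one_arrival_finite; lra).
  assert (Hoff2 : Rbar_le (offline_time B sigma2) B)
    by (apply offline_two_arrivals_le; unfold E0; fold b; lra).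
  assert (Hpos : forall sigma, (forall t, 0 <= t ->
    harvested sigma t <= E0 + (B - b)) -> Rbar_le b (offline_time B sigma)).
  { intros sigma Hs; apply offline_time_ge.
    intros P T [HP HPe] HT HB.
    apply (Hlate P T (harvested sigma T)); auto. }
  assert (Hpos1 : Rbar_le b (offline_time B sigma1))
    by (apply Hpos; intros; rewrite Hharv1; lra).
  pose proof (Hpos sigma2 Hharv2) as Hpos2.
  destruct (alg_feasible A sigma1) as [HP1 HE1].
  destruct (alg_feasible A sigma2) as [HP2 HE2].
  (* Competitiveness on [sigma1] forces completion there, at some [T1], so few bits are sent by time
     [b]. *)
  assert (Hfin1 : Rbar_lt (online_time B A sigma1) p_infty).
  { apply Rbar_le_lt_trans with (Finite (rA * offline_time B sigma1)); [|exact I].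
    apply competitive_completes; [exact hA| |exact Hoff1].
    destruct (offline_time B sigma1); simpl in *; lra || contradiction. }
  destruct (completion_time_lt_p_infty _ _ Hfin1) as (T1 & HT1 & HB1).
  specialize (HE1 T1 HT1); rewrite Hharv1 in HE1 by exact HT1.
  assert (HbT1 : b <= T1) by (apply (Hlate (A sigma1) T1 E0); auto; lra).
  assert (Hearly : ln 2 * bits_sent (A sigma2) b <= b / 40 + 40 * (E0 - b)).
  { rewrite <- (bits_sent_eq (A sigma1)).
    - apply (few_bits_early B E0 (A sigma1) b T1); trivial; lra.
    - lra.
    - intros u Hu.
      apply (alg_causal A sigma1 sigma2 u); [lra| |lra].
      apply same_arrivals_before_second; lra. }
  assert (Hon2 : Rbar_le (2 * b) (online_time B A sigma2)).
  { apply completion_time_ge.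
    intros T HT HB.
    destruct (Rle_dec (2 * b) T) as [H|H]; [exact H|exfalso].
    pose proof (bits_sent_le (A sigma2) T (2 * b) HP2 ltac:(lra)) as Hmono.
    assert (Hb2b : 0 <= b <= 2 * b) by lra.
    pose proof (bits_sent_Chasles (A sigma2) b (2 * b) HP2 Hb2b) as Hbits.
    pose proof (RInt_log2_le_affine (A sigma2) b (2 * b) _ _ HP2 Hb2b
      ln_1p_le_tangent_1) as Hsecond.
    pose proof (energy_used_Chasles (A sigma2) b (2 * b) HP2 Hb2b) as Hen.
    pose proof (RInt_profile_ge_0 (A sigma2) 0 b HP2 ltac:(lra)) as Hen0.
    fold (energy_used (A sigma2) b) in Hen0.
    pose proof (HE2 (2 * b) ltac:(lra)) as He.
    pose proof (Hharv2 (2 * b) ltac:(lra)) as Hh.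
    (* Contradiction by budget, in units of [b]: at most [1/40 + 40/10000] before [b]; after [b] at
       most 0.2 plus half the total energy, about 0.725. The sum is below 0.96. *)
    assert (Hsum : b <= ln 2 * bits_sent (A sigma2) (2 * b))
      by (rewrite HB in Hmono; unfold b at 1; nra).
    rewrite Hbits, Rmult_plus_distr_l in Hsum.
    assert ((ln 2 - / 2) * (2 * b - b) <= 0.2 * b) by nra.
    unfold E0 in *; lra. }
  destruct (offline_time B sigma2) as [f| |] eqn:Hf; simpl in Hoff2, Hpos2;
    try contradiction.
  assert (Hcomp : Rbar_le (online_time B A sigma2) (rA * f)).
  { change f with (real (Finite f)); rewrite <- Hf.
    apply competitive_completes; [exact hA| |]; rewrite Hf; simpl; trivial; lra. }
  pose proof (Rbar_le_trans _ _ _ Hon2 Hcomp) as Hle; simpl in Hle.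
  (* If [rA < 1.38], then [rA * f < 1.38 * B < 2 * b] because [0 < f <= B] and [0.69 * B < b]. *)
  destruct (Rle_dec 1.38 rA) as [H|H]; [exact H|nra].
Qed.
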